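(* Consider the controlled system $$x_{k+1}=f(x_k,\,r_0+u_k),\qquad k\ge 0,$$ where, for given $\varepsilon>0$ with $\varepsilon<\frac{\|P_i-P_j\|}{\sqrt2}$ for all $i\ne j$, the control is $$u_k=\begin{cases}0 & \text{if } k<k_0,\\ \gamma_{(i+k-k_0)\,\mathrm{mod}(m)}\,(x_k-x_{k-m}) & \text{if } k\ge k_0,\end{cases}$$ with $$k_0=k_0(x_0,\varepsilon)=\min\Big\{k\ge m:\ \|(x_k,x_{k-1},\dots,x_{k-m})-P_i\|\le\tfrac{\varepsilon}{\sqrt2}\ \text{for some } i,\ 1\le i\le m\Big\},$$ and $i$ in the definition of $u_k$ being the index for which $\|(x_{k_0},\dots,x_{k_0-m})-P_i\|\le\frac{\varepsilon}{\sqrt2}$. Suppose that the real coefficients $\gamma_j$, $1\le j\le m$, are such that all the roots of $$\chi(\lambda)=-\lambda^{m+1}+\prod_{i=1}^m\big(a^{(i)}_{1(m+1)}+\lambda\,a^{(i)}_{11}\big)$$ are of modulus less than one, and let $\gamma=\max_{1\le j\le m}|\gamma_j|$. Let $\delta>0$ be given. Then there exists $\varepsilon_0$ with $$0<\varepsilon_0<\min_{i\neq j}\Big\{\frac{\|P_i-P_j\|}{\sqrt2};\ \frac{\delta}{\gamma}\Big\}$$ such that for all $\varepsilon$ with $0<\varepsilon<\varepsilon_0$, and for almost every initial condition $x_0\in\mathcal{B}$, one has $|u_k|\le\delta$ (for all $k$), and $(x_k)_{k\ge1}$ converges to the $m$-periodic orbit $\{p_1,\dots,p_m\}$.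
   Context: Setting: $f(x,r)$ is a real-valued, continuously differentiable function of the real state $x$ and the real scalar parameter $r$, with partial derivatives $f_x,f_r$. For the nominal value $r=r_0$ the uncontrolled system $x_{k+1}=f(x_k,r_0)$ is chaotic, with a strange attractor $\mathcal{A}$ contained in its basin of attraction $\mathcal{B}\subset\mathbb{R}$. The set $\{p_1,\dots,p_m\}$ is an unstable periodic orbit (UPO) of period $m$ of the uncontrolled system, embedded in the attractor: the $p_i$ are distinct and $p_{i+1}=f(p_i,r_0)$, with indices taken modulo $m$ in $\{1,\dots,m\}$. Standing ergodicity assumption: for almost every initial condition $x_0\in\mathcal{B}$, the trajectory of the uncontrolled system visits every neighborhood of every point of the UPO (so $k_0$ exists for almost every $x_0\in\mathcal{B}$). Notation: $P_i=(p_i,p_{i-1},\dots,p_1,p_m,p_{m-1},\dots,p_i)\in\mathbb{R}^{m+1}$, $1\le i\le m$ (going once backwards around the orbit from $p_i$ to $p_i$); $\|\cdot\|$ is the Euclidean norm. For given $\gamma_i$, $$a^{(i)}_{11}=f_x(p_i,r_0)+\gamma_i f_r(p_i,r_0),\qquad a^{(i)}_{1(m+1)}=-\gamma_i f_r(p_i,r_0).$$ The polynomial $\chi$ is (up to sign) the characteristic polynomial of the product $\prod_{i=1}^m J_i$, where $J_i$ is the $(m+1)\times(m+1)$ companion matrix with first row $(a^{(i)}_{11},0,\dots,0,a^{(i)}_{1(m+1)})$ (for $m=1$, $(a^{(1)}_{11},a^{(1)}_{12})$), ones on the subdiagonal, and zeros elsewhere. Conventions: $\delta$ is the maximal allowed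 parameter perturbation; $\delta/\gamma$ is read as $+\infty$ if $\gamma=0$, and for $m=1$ the conditions on $\|P_i-P_j\|$ are void. Convergence of $(x_k)$ to the periodic orbit means that for some index $s$, $|x_k-p_{(s+k)\,\mathrm{mod}(m)}|\to0$ as $k\to\infty$. *)

(* Defs.v *)
(* MathComp-Analysis, over an arbitrary [R : realType]. *)
From HB Require Import structures.
From mathcomp Require Import all_boot all_order all_algebra.
From mathcomp Require Import complex.
From mathcomp Require Import all_classical all_reals all_analysis.

Set Implicit Arguments.
Unset Strict Implicit.
Unset Printing Implicit Defensive.
Import Order.TTheory GRing.Theory Num.Theory.
Import numFieldNormedType.Exports.

Local Open Scope classical_set_scope.
Local Open Scope ring_scope.

(* Periods are written m = n.+1, and the m points of a periodic orbit are      *)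
(* indexed by 'I_n.+1, whose addition is addition modulo m; [inZp k] is the    *)
(* class of [k : nat].  Thus the indices run over 0, ..., m - 1, and the index *)
(* m of the range 1, ..., m is represented by 0.                               *)

Section Plant.
Variable R : realType.
Implicit Types (f : R -> R -> R) (g : R -> R) (A B : set R).

Definition f_x f (x r : R) : R := derive1 (f^~ r) x.
Definition f_r f (x r : R) : R := derive1 (f x) r.

Definition continuously_differentiable f : Prop :=
  [/\ forall z : R * R, differentiable (fun w : R * R => f w.1 w.2) z,
      continuous (fun z : R * R => f_x f z.1 z.2) &
      continuous (fun z : R * R => f_r f z.1 z.2)].

(* Initial states whose trajectory tends to A in distance. *)
Definition basin_of_attraction g A : set R :=
  [set x | forall e, 0 < e ->
     \forall k \near \oo, exists2 a, A a & `|iter k g x - a| < e].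

Definition topologically_transitive g A : Prop :=
  forall U V : set R, open U -> open V ->
    A `&` U !=set0 -> A `&` V !=set0 ->
    exists k, exists2 x, (A `&` U) x & V (iter k g x).

Definition sensitive_dependence g A : Prop :=
  exists2 b, 0 < b & forall x, A x -> forall d, 0 < d ->
    exists y k, [/\ A y, `|y - x| < d & b < `|iter k g y - iter k g x|].

Definition chaotic_on g A : Prop :=
  topologically_transitive g A /\ sensitive_dependence g A.

(* Attraction is required in the weak (measure-theoretic) sense, so that the   *)
(* basin need not be a neighbourhood of A: for x |-> 4x(1-x) on the whole line *)
(* both the attractor and its basin are [0, 1].                                *)
Definition strange_attractor g A : Prop :=
  [/\ A !=set0, compact A, g @` A = A,
      ~ (@lebesgue_measure R).-negligible (basin_of_attraction g A) &
      chaotic_on g A].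

Section PeriodicOrbit.
Variable n : nat.
Implicit Types (p : 'I_n.+1 -> R).

Definition periodic_orbit g p : Prop :=
  injective p /\ forall i, p (i + inZp 1) = g (p i).

Definition stable_orbit g p : Prop :=
  forall e, 0 < e -> exists2 d, 0 < d &
    forall x i, `|x - p i| < d -> forall k, `|iter k g x - p (i + inZp k)| < e.

Definition UPO g p : Prop := periodic_orbit g p /\ ~ stable_orbit g p.

Definition ergodicity_assumption g p B : Prop :=
  {ae @lebesgue_measure R, forall x0 : R, B x0 ->
     forall (i : 'I_n.+1) (U : set R), nbhs (p i) U ->
       exists k, U (iter k g x0)}.

(* [`| . |] on row vectors is the sup norm in the library. *)
Definition eucl_norm d (v : 'rV[R]_d) : R := Num.sqrt (\sum_j v 0 j ^+ 2).

(* P_i = (p_i, p_(i-1), ..., p_(i-m)), indices modulo m *)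
Definition orbit_window p (i : 'I_n.+1) : 'rV[R]_n.+2 :=
  \row_(j < n.+2) p (i - inZp j).

(* (x_k, x_(k-1), ..., x_(k-m)); only meaningful for m <= k *)
Definition window (x : nat -> R) (k : nat) : 'rV[R]_n.+2 :=
  \row_(j < n.+2) x (k - j)%N.

Section ClosedLoop.
Variables (f : R -> R -> R) (r0 : R) (p gamma : 'I_n.+1 -> R).

Definition a11 (i : 'I_n.+1) : R := f_x f (p i) r0 + gamma i * f_r f (p i) r0.
Definition a1m1 (i : 'I_n.+1) : R := - (gamma i * f_r f (p i) r0).

Definition chi : {poly R} :=
  - 'X^(n.+2) + \prod_(i < n.+1) ((a1m1 i)%:P + 'X * (a11 i)%:P).

Definition captured (eps : R) (x : nat -> R) (k : nat) (i : 'I_n.+1) : bool :=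
  eucl_norm (window x k - orbit_window p i) <= eps / Num.sqrt 2.

(* k0 is the least k >= m at which the window of x is captured by some P_i. *)
Definition is_k0 (eps : R) (x : nat -> R) (k0 : nat) : Prop :=
  [/\ (n.+1 <= k0)%N, exists i, captured eps x k0 i &
      forall k, (n.+1 <= k)%N -> (exists i, captured eps x k i) -> (k0 <= k)%N].

(* The first clause also covers the case in which k0 does not exist: the       *)
(* control then vanishes for ever.                                             *)
Definition feedback (eps : R) (x u : nat -> R) : Prop :=
  (forall k, (forall k0, is_k0 eps x k0 -> (k < k0)%N) -> u k = 0) /\
  (forall k0, is_k0 eps x k0 -> exists2 i, captured eps x k0 i &
     forall k, (k0 <= k)%N ->
       u k = gamma (i + inZp (k - k0)) * (x k - x (k - n.+1)%N)).

Definition closed_loop (eps x0 : R) (x u : nat -> R) : Prop :=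
  [/\ x 0%N = x0, forall k, x k.+1 = f (x k) (r0 + u k) & feedback eps x u].


(* For every initial state the controlled system has a solution. *)
Lemma closed_loop_exists eps x0 : exists x u, closed_loop eps x0 x u.
Proof.
pose g := f^~ r0; pose y k := iter k g x0.
have ext (x x' : nat -> R) k i : (forall j, (j <= k)%N -> x j = x' j) ->
    captured eps x k i = captured eps x' k i.
  move=> h; rewrite /captured; congr (eucl_norm (_ - _) <= _).
  by apply/rowP => j; rewrite !mxE h // leq_subr.
have uniq x k l : is_k0 eps x k -> is_k0 eps x l -> k = l.
  move=> [a b c] [a' b' c']; apply/eqP; rewrite eqn_leq.
  by apply/andP; split; [exact: c|exact: c'].
have [[k0 k0P]|nok0] := pselect (exists k0, is_k0 eps y k0); last first.
  exists y, (fun=> 0); split=> //; first by move=> k; rewrite addr0.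
  split=> // k0 k0P; exfalso; apply: nok0; by exists k0.
have [mk0 [i ci] k0min] := k0P.
pose W := fix W t : nat -> R := if t is t'.+1 then fun j =>
    if j is j'.+1 then W t' j' else
    f (W t' 0%N) (r0 + gamma (i + inZp t') * (W t' 0%N - W t' n.+1))
  else fun j => y (k0 - j)%N.
pose x k := if (k <= k0)%N then y k else W (k - k0)%N 0%N.
have Wx t j : (j <= k0 + t)%N -> W t j = x (k0 + t - j)%N.
  elim: t j => [|t IH] j.
    by rewrite addn0 /x => _; rewrite leq_subr.
  case: j => [_|j]; last by rewrite addnS subSS ltnS => /IH.
  rewrite subn0 /x addnS leqNgt ltnS leq_addr /=.
  by rewrite -addnS addKn.
pose u k := if (k < k0)%N then 0
  else gamma (i + inZp (k - k0)) * (x k - x (k - n.+1)%N).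
have xy k : (k <= k0)%N -> x k = y k by rewrite /x => ->.
have xk0 : is_k0 eps x k0.
  split=> //; first by exists i; rewrite (ext _ y).
  move=> k mk [j cj]; rewrite leqNgt; apply/negP => kk0.
  have := k0min k mk; rewrite leqNgt kk0 /= => h.
  suff : false by []; apply: h; exists j; rewrite -(ext x) // => l lk.
  by rewrite xy // (leq_trans lk) // ltnW.
exists x, u; split; first by rewrite xy.
  move=> k; rewrite /u; case: ltnP => kk0.
    by rewrite !xy ?(ltnW kk0) // addr0.
  rewrite {1}/x leqNgt ltnS kk0 /= subSn //=.
  have le1 : (n.+1 <= k0 + (k - k0))%N by rewrite subnKC // (leq_trans mk0).
  by rewrite !Wx // subn0 subnKC.
split=> [k /(_ _ xk0) kk0|l /(uniq _ _ _ xk0) <-]; first by rewrite /u kk0.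
exists i; first by rewrite (ext _ y).
by move=> k k0k; rewrite /u ltnNge k0k.
Qed.

End ClosedLoop.

Definition converges_to_orbit p (x : nat -> R) : Prop :=
  exists s : 'I_n.+1, (fun k => `|x k - p (s + inZp k)|) @ \oo --> (0 : R).

End PeriodicOrbit.
End Plant.

(* Main.v *)
Require Import Defs.
From HB Require Import structures.
From mathcomp Require Import all_boot all_order all_algebra.
From mathcomp Require Import complex.
From mathcomp Require Import all_classical all_reals all_analysis.
From mathcomp Require Import ring lra zify.
Import Order.TTheory GRing.Theory Num.Theory.
Import numFieldNormedType.Exports.
Local Open Scope classical_set_scope.
Local Open Scope ring_scope.
Set Implicit Arguments.
Unset Strict Implicit.
Unset Printing Implicit Defensive.

(** Let e_k be the difference between x_k and the orbit point that x_k follows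
    after the control has been switched on.  Differentiating
    the closed loop at (p_i, r0) gives
      e_(k+1) = a_k e_k + b_k e_(k-m) + o(|e_k| + |e_(k-m)|),
    where a_k = a11 and b_k = a1m1 at the current orbit point have period m in
    k.  So everything rests on the linear periodic delay equation, and on the
    passage from it to the nonlinear one.

    Linear part.  Let T be the shift by one period.  It commutes with the
    m-periodic coefficients, so the equation z_(k+m+1) = a_k z_(k+m) + b_k z_k
    reads T z_(k+1) = (b_k + a_k T) z_k; following it through one period and
    using z_(k+m) = T z_k gives T^(m+1) z = \prod_i (b_i + a_i T) z, that is
    chi(T) z = 0.  Over the complex numbers chi(T) is, up to a constant, a
    product of factors T - lambda with |lambda| < 1; if (T - lambda) y tends to
    0, so does y (cvg0_contract), and hence every solution tends to 0 along the
    multiples of the period (delay_recurrence_cvg0).  As solutions depend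
    linearly on a window of m + 1 consecutive values and there are only m
    phases, some fixed number N of steps halves the norm of every window
    (delay_flow_contracts).

    Nonlinear part.  Over N steps the nonlinear flow differs from the linear
    one by o(|w|), so near 0 it contracts by 3/4 and, iterating, decays
    exponentially (flow_exp_stable).  Hence for small eps a captured window
    stays as close to the orbit as desired, which bounds the control by delta,
    and it converges to the orbit.

    Capture.  An uncontrolled trajectory that comes very close to p_0 follows
    the orbit for one whole period by continuity, so that its window is then
    close to P_0; ergodicity makes this happen for almost every initial state
    (k0_exists). *)

(** * Recurrences annihilated by a polynomial with roots in the unit disc *)

(** Past the index from which d stays below (1 - rho) e / 2, the excess
    c_j - e / 2 shrinks geometrically. *)
Lemma cvg0_contract (R : realType) (rho : R) (c d : nat -> R) :
  0 <= rho -> rho < 1 -> (forall j, 0 <= c j) ->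
  (forall j, c j.+1 <= rho * c j + d j) ->
  d @ \oo --> (0 : R) -> c @ \oo --> (0 : R).
Proof.
move=> rho0 rho1 c0 cS /cvgr0Pnorm_le d0; apply/cvgr0Pnorm_le => e e0.
have e1 : 0 < e / 2 * (1 - rho) by rewrite mulr_gt0 ?divr_gt0 ?subr_gt0.
have [K _ dK] := d0 _ e1.
have cK j : c (K + j)%N - e / 2 <= rho ^+ j * c K.
  elim: j => [|j IH].
    by rewrite addn0 expr0 mul1r lerBlDr lerDl divr_ge0 ?ltW.
  have dj := le_trans (ler_norm _) (dK (K + j)%N (leq_addr _ _)).
  rewrite addnS exprS -mulrA; apply: le_trans (ler_wpM2l rho0 IH).
  by rewrite mulrBr; have := cS (K + j)%N; lra.
have geo : (fun j => rho ^+ j * c K) @ \oo --> (0 : R).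
  rewrite -(mul0r (c K)); apply: cvgM; last exact: cvg_cst.
  by apply: cvg_expr; rewrite ger0_norm.
move/cvgr0Pnorm_le: geo => /(_ (e / 2)) [|N _ geoN]; first by rewrite divr_gt0.
exists (K + N)%N => // j /= KNj.
have Kj : (K <= j)%N by rewrite (leq_trans _ KNj) ?leq_addr.
have /geoN : (N <= j - K)%N by rewrite leq_subRL.
move/(le_trans (ler_norm _)) => /= h.
by rewrite ger0_norm // -(subnKC Kj); have := cK (j - K)%N; lra.
Qed.

Section Moment.
Variables (K : comNzRingType) (s : nat -> K).
Implicit Types q : {poly K}.

(** The linear functional on polynomials that sends 'X^i to s i.  It turns the
    action of a polynomial in the shift operator on the sequence s into the
    multiplication of polynomials. *)
Definition moment q : K := \sum_(i < size q) q`_i * s i.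

Lemma moment_widen N q : (size q <= N)%N -> moment q = \sum_(i < N) q`_i * s i.
Proof.
move=> qN; rewrite /moment (big_ord_widen _ (fun i => q`_i * s i) qN) big_mkcond.
apply: eq_bigr => i _; case: ltnP => // qi.
by rewrite nth_default ?mul0r.
Qed.

Lemma moment_is_scalar : scalar moment.
Proof.
move=> a q q'; have [N [Nq Nq' Nqq']] : exists N : nat,
    [/\ (size q <= N)%N, (size q' <= N)%N & (size (a *: q + q')%R <= N)%N].
  by exists (size q + size q' + size (a *: q + q')%R)%N; split; lia.
rewrite !(moment_widen Nq, moment_widen Nq', moment_widen Nqq').
rewrite mulr_sumr -big_split; apply: eq_bigr => i _ /=.
by rewrite coefD coefZ mulrDl mulrA.
Qed.

HB.instance Definition _ := GRing.isLinear.Build K {poly K} K *%R moment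
  moment_is_scalar.

Lemma momentXn j : moment 'X^j = s j.
Proof.
rewrite /moment size_polyXn big_ord_recr /= coefXn eqxx mul1r big1 ?add0r // => i _.
by rewrite coefXn ltn_eqF ?mul0r.
Qed.

End Moment.

Lemma momentXM (K : comNzRingType) (s : nat -> K) q :
  moment s ('X * q) = moment (fun i => s i.+1) q.
Proof.
have h : (size ('X * q)%R <= (size q).+1)%N.
  by rewrite (leq_trans (size_polyMleq _ _)) // size_polyX.
rewrite (moment_widen _ h) big_ord_recl coefXM mul0r add0r.
by apply: eq_bigr => i _; rewrite coefXM.
Qed.

Local Notation normc := ComplexField.Normc.normc.

Lemma normc_lt1 (R : realType) (z : R[i]) : `|z| < 1 -> normc z < 1.
Proof. by rewrite normc_def -(rmorph1 (real_complex R)) ltcR; case: z. Qed.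

Lemma normc_ge0 (R : realType) (z : R[i]) : 0 <= normc z.
Proof. by case: z => a b; rewrite sqrtr_ge0. Qed.

(** The functional L kills the ideal of multiples of u \prod_z ('X - z).  The
    factors are removed one at a time: modulo a term tending to 0 by induction,
    multiplying 'X^j u by 'X is multiplying it by the root z.  The factor u
    collects those already removed. *)
Lemma cvg_scalar_powers (R : realType) (L : {scalar {poly R[i]}})
    (r : seq R[i]) (u : {poly R[i]}) :
  (forall z, z \in r -> `|z| < 1) ->
  (forall q, L (q * (u * \prod_(z <- r) ('X - z%:P))) = 0) ->
  (fun j => normc (L ('X^j * u))) @ \oo --> (0 : R).
Proof.
elim: r u => [|z r IH] u r1 Lu.
  rewrite [X in X @ _](_ : _ = fun=> 0); first exact: cvg_cst.
  apply/funext => j; have := Lu 'X^j; rewrite big_nil mulr1 => ->.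
  exact: ComplexField.Normc.normc0.
have z1 := normc_lt1 (r1 z (mem_head _ _)).
have d0 : (fun j => normc (L ('X^j * (u * ('X - z%:P))))) @ \oo --> (0 : R).
  apply: IH => [y yr|q]; first by rewrite r1 // in_cons yr orbT.
  by have := Lu q; rewrite big_cons !mulrA.
apply: (cvg0_contract (normc_ge0 z) z1 _ _ d0) => j; first exact: normc_ge0.
rewrite -ComplexField.Normc.normcM.
apply: le_trans (le_normcD _ _).
rewrite -[z * L _]linearZ -linearD le_eqVlt; apply/orP/or_introl/eqP.
congr (normc (L _)); rewrite exprS -mul_polyC; ring.
Qed.

(** * The periodic delay equation *)

Section DelayRecurrence.
Variables (K : comNzRingType) (m : nat) (z a b : nat -> K).
Hypotheses (aP : forall k, a (k + m)%N = a k) (bP : forall k, b (k + m)%N = b k).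
Hypothesis zS : forall k, z (k + m).+1 = a k * z (k + m)%N + b k * z k.

(** Here 'X stands for the shift by one whole period, which is why it commutes
    with the periodic coefficients in the lemmas below. *)
Definition stride_moment k : {poly K} -> K := moment (fun i => z (k + i * m)%N).

HB.instance Definition _ k := GRing.Linear.on (stride_moment k).

Lemma period_mul (c : nat -> K) k i : (forall k, c (k + m)%N = c k) ->
  c (k + i * m)%N = c k.
Proof. by move=> cP; elim: i => [|i IH]; rewrite ?addn0 // mulSnr addnA cP. Qed.

Lemma stride_momentS k q :
  stride_moment k.+1 ('X * q) = stride_moment k (((b k)%:P + 'X * (a k)%:P) * q).
Proof.
rewrite /stride_moment mulrDl ['X * _%:P]mulrC -mulrA !mul_polyC raddfD /=.
rewrite [X in _ = X + _]linearZ [X in _ = _ + X]linearZ /= !momentXM.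
rewrite /moment !mulr_sumr -big_split; apply: eq_bigr => i _ /=.
have -> : (k.+1 + i.+1 * m = (k + i * m + m).+1)%N by lia.
rewrite zS (period_mul _ _ aP) (period_mul _ _ bP).
by rewrite mulSn (addnC m) addnA; ring.
Qed.

Lemma stride_moment_steps k i q :
  stride_moment (k + i) ('X^i * q) =
  stride_moment k ((\prod_(l < i) ((b (k + l)%N)%:P + 'X * (a (k + l)%N)%:P)) * q).
Proof.
elim: i q => [|i IH] q; first by rewrite addn0 big_ord0 expr0.
rewrite addnS exprS -mulrA stride_momentS mulrCA IH big_ord_recr /=.
by rewrite mulrA.
Qed.

(** After one period the index has moved by m, which is one more factor 'X. *)
Lemma stride_moment_char k q :
  stride_moment k ((- 'X^(m.+1) +
    \prod_(l < m) ((b (k + l)%N)%:P + 'X * (a (k + l)%N)%:P)) * q) = 0.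
Proof.
rewrite mulrDl raddfD mulNr raddfN /= -stride_moment_steps addrC.
apply/eqP; rewrite subr_eq0 exprS -mulrA; apply/eqP.
rewrite [RHS]momentXM.
by congr (moment _ _); apply/funext => i; rewrite mulSn addnA.
Qed.

End DelayRecurrence.

(** For m-periodic a and b this is, up to sign, the characteristic polynomial of
    the monodromy matrix of z_(k+m+1) = a_k z_(k+m) + b_k z_k. *)
Definition delay_char (K : comNzRingType) m (a b : nat -> K) : {poly K} :=
  - 'X^(m.+1) + \prod_(l < m) ((b l)%:P + 'X * (a l)%:P).

(** The product has degree at most m, so the coefficient of 'X^(m.+1) is -1. *)
Lemma delay_char_neq0 (K : idomainType) m (a b : nat -> K) :
  delay_char m a b != 0.
Proof.
apply/eqP => /polyP/(_ m.+1)/eqP; rewrite coefD coefN coefXn eqxx coef0.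
rewrite nth_default ?addr0 ?oppr_eq0 ?oner_eq0 //.
apply: leq_trans (size_poly_prod_leq _ _) _; rewrite card_ord.
have : (\sum_(l < m) size ((b l)%:P + 'X * (a l)%:P)%R <= \sum_(l < m) 2)%N.
  apply: leq_sum => l _; apply: leq_trans (size_polyD _ _) _.
  rewrite geq_max (leq_trans (size_polyC_leq1 _)) //=.
  rewrite mulrC mul_polyC (leq_trans (size_scale_leq _ _)) ?size_polyX //.
by rewrite sum_nat_const card_ord => h; rewrite leq_subLR addnS ltnS addnn -muln2.
Qed.

(** The characteristic polynomial kills the moments of z and splits over R[i],
    so that cvg_scalar_powers applies with u = 1. *)
Lemma delay_recurrence_cvg0 (R : realType) m (z a b : nat -> R) k :
  (forall k, a (k + m)%N = a k) -> (forall k, b (k + m)%N = b k) ->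
  (forall k, z (k + m).+1 = a k * z (k + m)%N + b k * z k) ->
  (forall y : R[i], root (map_poly (real_complex R)
      (delay_char m (fun l => a (k + l)%N) (fun l => b (k + l)%N))) y ->
    `|y| < 1) ->
  (fun j => z (k + j * m)%N) @ \oo --> (0 : R).
Proof.
move=> aP bP zS chi1; pose c (s : nat -> R) i := real_complex R (s i).
set chi := map_poly _ _ in chi1.
have [r chiE] := closed_field_poly_normal chi.
have chi0 : lead_coef chi != 0.
  by rewrite lead_coef_eq0 map_poly_eq0 delay_char_neq0.
have r1 y : y \in r -> `|y| < 1.
  move=> yr; apply: chi1; rewrite chiE rootZ // root_prod_XsubC //.
have chiM : chi = - 'X^(m.+1) +
    \prod_(l < m) ((c b (k + l)%N)%:P + 'X * (c a (k + l)%N)%:P).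
  rewrite /chi /delay_char rmorphD rmorphN /= map_polyXn rmorph_prod; congr (_ + _).
  by apply: eq_bigr => l _; rewrite rmorphD rmorphM /= !map_polyC map_polyX.
have Lchi (q : {poly R[i]}) :
    stride_moment m (c z) k (q * (1 * \prod_(y <- r) ('X - y%:P))) = 0.
  have : stride_moment m (c z) k (chi * q) = 0.
    rewrite chiM; apply: stride_moment_char => l; rewrite /c ?aP ?bP //.
    by rewrite zS rmorphD !rmorphM.
  rewrite chiE -scalerAl linearZ /= => /eqP.
  by rewrite mulf_eq0 (negbTE chi0) /= mul1r mulrC => /eqP.
have := cvg_scalar_powers r1 Lchi.
move=> /cvgr0Pnorm_le h; apply/cvgr0Pnorm_le => e e0.
have := h e e0; apply: filterS => j /=.
rewrite mulr1 [stride_moment _ _ _ _]momentXn /=.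
by rewrite expr0n addr0 sqrtr_sqr normr_id.
Qed.

(** * Stability of time-varying systems by linearization *)

Section TimeVarying.
Variables (R : realType) (V : normedModType R).

(** The state reached from w after the k steps F s, F (s + 1), ...,
    F (s + k - 1). *)
Fixpoint flow (F : nat -> V -> V) (s : nat) (w : V) (k : nat) : V :=
  if k is k'.+1 then F (s + k')%N (flow F s w k') else w.

Lemma flowD F s w j k : flow F s w (j + k) = flow F (s + j) (flow F s w j) k.
Proof. by elim: k => [|k IH]; rewrite ?addn0 // addnS /= IH addnA. Qed.

Variables (F : nat -> V -> V) (L : nat -> {additive V -> V}) (K : R).
Hypothesis K1 : 1 <= K.
Hypothesis LK : forall k w, `|L k w| <= K * `|w|.
Hypothesis FL : forall eta, 0 < eta -> exists2 rho, 0 < rho &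
  forall k w, `|w| <= rho -> `|F k w - L k w| <= eta * `|w|.

Let K0 : 0 <= K. Proof. exact: le_trans K1. Qed.

Lemma flow_linear_le s w k : `|flow L s w k| <= K ^+ k * `|w|.
Proof.
elim: k => [|k IH]; first by rewrite mul1r.
by rewrite /= exprS -mulrA (le_trans (LK _ _)) // ler_wpM2l.
Qed.

(** A chain rule at the fixed point 0, uniform in the starting time: one more
    step adds the linearization error of F at a point of norm O(|w|) and the
    image under L of the error accumulated before. *)
Lemma flow_linearization k eta : 0 < eta -> exists2 rho, 0 < rho &
  forall s w, `|w| <= rho -> `|flow F s w k - flow L s w k| <= eta * `|w|.
Proof.
elim: k eta => [|k IH] eta eta0.
  by exists 1 => // s w _; rewrite subrr normr0 mulr_ge0 // ltW.
pose C := K ^+ k + 1.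
have C0 : 0 < C by rewrite ltr_wpDl // exprn_ge0.
have K0' : 0 < K by exact: lt_le_trans K1.
have [|rho1 rho10 h1] := IH (Num.min 1 (eta / 2 / K)).
  by rewrite lt_min ltr01 !divr_gt0.
have [|rho2 rho20 h2] := FL (eta := eta / 2 / C); first by rewrite !divr_gt0.
exists (Num.min rho1 (rho2 / C)); first by rewrite lt_min rho10 divr_gt0.
move=> s w; rewrite le_min => /andP[w1 w2] /=.
set x := flow F s w k; set y := flow L s w k.
have := h1 s w w1; rewrite -/x -/y minr_pMl // le_min mul1r => /andP[xy1 xy2].
have xC : `|x| <= C * `|w|.
  rewrite -(subrK y x) (le_trans (ler_normD _ _)) // addrC mulrDl mul1r lerD //.
  exact: flow_linear_le.
have -> : F (s + k)%N x - L (s + k)%N y =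
    (F (s + k)%N x - L (s + k)%N x) + L (s + k)%N (x - y).
  by rewrite raddfB addrA subrK.
apply: le_trans (ler_normD _ _) _; rewrite [eta in leRHS]splitr mulrDl lerD //.
  have xrho : `|x| <= rho2 by rewrite (le_trans xC) // mulrC -ler_pdivlMr.
  apply: le_trans (h2 _ _ xrho) _; rewrite -mulrA ler_wpM2l ?divr_ge0 ?(ltW eta0) //.
  by rewrite mulrC ler_pdivrMr // mulrC.
apply: le_trans (LK _ _) _; rewrite mulrC -ler_pdivlMr // (le_trans xy2) //.
by rewrite mulrAC.
Qed.

Variable N : nat.
Hypothesis N0 : (0 < N)%N.
Hypothesis LN : forall s w, `|flow L s w N| <= `|w| / 2.

(** Blocks of N steps contract by 1/2 + 1/4 = 3/4 near 0; the constant C covers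
    the transient inside a block. *)
Lemma flow_exp_stable : exists2 rho, 0 < rho & exists2 C, 0 < C &
  forall s w k, `|w| <= rho ->
    `|flow F s w k| <= C * (3 / 4) ^+ (k %/ N) * `|w|.
Proof.
pose C := K ^+ N + 1; have C0 : 0 < C by rewrite ltr_wpDl // exprn_ge0.
have transient M : (M <= N)%N -> exists2 rho, 0 < rho &
    forall s w k, (k <= M)%N -> `|w| <= rho -> `|flow F s w k| <= C * `|w|.
  elim: M => [_|M IH MN].
    exists 1 => // s w k; rewrite leqn0 => /eqP -> _ /=.
    by rewrite ler_peMl // lerDr exprn_ge0.
  have [rho1 rho10 h1] := IH (ltnW MN).
  have [rho2 rho20 h2] := flow_linearization M.+1 ltr01.
  exists (Num.min rho1 rho2); first by rewrite lt_min rho10.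
  move=> s w k; rewrite leq_eqVlt ltnS le_min => /orP[/eqP ->|kM] /andP[w1 w2].
    rewrite -(subrK (flow L s w M.+1) (flow F _ _ _)) addrC mulrDl.
    apply: le_trans (ler_normD _ _) _; rewrite lerD // ?h2 //.
    apply: le_trans (flow_linear_le _ _ _) _.
    by rewrite ler_wpM2r // ler_weXn2l.
  exact: h1.
have [rho1 rho10 h1] := transient N (leqnn N).
have [|rho2 rho20 h2] := @flow_linearization N (1 / 4); first by rewrite divr_gt0.
exists (Num.min rho1 rho2); first by rewrite lt_min rho10.
exists C => // s w k wrho.
have block q : `|flow F s w (q * N)| <= (3 / 4) ^+ q * `|w|.
  elim: q => [|q IH]; first by rewrite mul0n mul1r.
  have wq : `|flow F s w (q * N)| <= `|w|.
    apply: le_trans IH _; rewrite ler_piMl // exprn_ile1 //; lra.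
  rewrite mulSnr flowD exprS -mulrA.
  set v := flow F s w (q * N) in IH wq *; set t := (s + q * N)%N.
  have : `|v| <= rho2 by rewrite (le_trans wq) // (le_trans wrho) // ge_min lexx orbT.
  move=> /(h2 t) Fv; have Lv := LN t v.
  have := ler_normD (flow F t v N - flow L t v N) (flow L t v N).
  rewrite subrK; lra.
rewrite {1}(divn_eq k N) flowD.
have wq := block (k %/ N)%N.
have vrho : `|flow F s w (k %/ N * N)%N| <= rho1.
  apply: (le_trans wq); apply: (@le_trans _ _ `|w|).
    by rewrite ler_piMl // exprn_ile1 //; lra.
  by rewrite (le_trans wrho) // ge_min lexx.
apply: le_trans (h1 _ _ _ _ vrho) _; first by rewrite ltnW // ltn_mod.
by rewrite -mulrA ler_wpM2l // ltW.
Qed.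

Lemma flow_asymptotically_stable r : 0 < r -> exists2 rho, 0 < rho &
  forall s w, `|w| <= rho ->
    (forall k, `|flow F s w k| <= r) /\
    (fun k => `|flow F s w k|) @ \oo --> (0 : R).
Proof.
move=> r0; have [rho rho0 [C C0 h]] := flow_exp_stable.
exists (Num.min rho (r / C)); first by rewrite lt_min rho0 divr_gt0.
move=> s w; rewrite le_min => /andP[wrho wr]; split=> [k|].
  apply: le_trans (h _ _ _ wrho) _; rewrite -mulrA mulrC -ler_pdivlMr //.
  by apply: le_trans wr; rewrite ler_piMl // exprn_ile1 //; lra.
have : (fun q => C * `|w| * (3 / 4) ^+ q) @ \oo --> (0 : R).
  rewrite -(mulr0 (C * `|w|)); apply: cvgM; first exact: cvg_cst.
  by apply: cvg_expr; rewrite ger0_norm; lra.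
move=> /cvgr0Pnorm_le small; apply/cvgr0Pnorm_le => e e0.
have [Q _ smallQ] := small e e0; exists (Q * N)%N => // k /= Qk.
have /smallQ : (Q <= k %/ N)%N by rewrite leq_divRL.
rewrite normr_id => /(le_trans (ler_norm _)); apply: le_trans.
by rewrite mulrAC h.
Qed.

End TimeVarying.

(** * Row vectors and partial derivatives *)

Lemma row_coord_le (R : realType) n (w : 'rV[R]_n) j : `|w 0 j| <= `|w|.
Proof.
rewrite [leRHS]mx_normrE.
pose F (ij : 'I_1 * 'I_n) := `|w ij.1 ij.2|; exact: (le_bigmax _ F (0, j)).
Qed.

Lemma row_norm_le (R : realType) n (w : 'rV[R]_n) c :
  0 <= c -> (forall j, `|w 0 j| <= c) -> `|w| <= c.
Proof.
move=> c0 wc; rewrite [leLHS]mx_normrE; apply: bigmax_le => // -[i j] _ /=.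
by rewrite ord1.
Qed.

(** First-order expansion at (x, r), with the differential expressed through
    the two partial derivatives by evaluating it on (1, 0) and (0, 1). *)
Lemma partial_remainder (R : realType) (f : R -> R -> R) (x r : R) (eta : R) :
  differentiable (fun w : R * R => f w.1 w.2) (x, r) -> 0 < eta ->
  exists2 rho, 0 < rho & forall h k, `|h| <= rho -> `|k| <= rho ->
    `|f (x + h) (r + k) - f x r - (f_x f x r * h + f_r f x r * k)|
      <= eta * Num.max `|h| `|k|.
Proof.
move=> df eta0; set g := fun w : R * R => f w.1 w.2.
have [_ /eqaddoP/(_ eta eta0)/nbhs_normP[e /= e0 small]] := (diff_locallyP _ _).1 df.
have dx : 'd g (x, r) (1, 0) = f_x f x r.
  rewrite -deriveE // /f_x derive1E /derive; apply: (congr1 (fun q => lim (q @ 0^'))).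
  by apply/funext => h /=; rewrite /g /= scaler0 add0r.
have dr : 'd g (x, r) (0, 1) = f_r f x r.
  rewrite -deriveE // /f_r derive1E /derive; apply: (congr1 (fun q => lim (q @ 0^'))).
  by apply/funext => h /=; rewrite /g /= scaler0 add0r.
exists (e / 2); first by rewrite divr_gt0.
move=> h k he ke.
have /small : ball_ Num.norm (0 : R * R) e (h, k).
  rewrite /ball_ /= sub0r normrN prod_normE /= gt_max.
  by apply/andP; split; [apply: le_lt_trans he _|apply: le_lt_trans ke _]; lra.
rewrite -[(_ - _) (h, k)]/(g (h + x, k + r) - (g (x, r) + 'd g (x, r) (h, k))).
have -> : 'd g (x, r) (h, k) = f_x f x r * h + f_r f x r * k.
  have -> : (h, k) = h *: ((1, 0) : R * R) + k *: ((0, 1) : R * R).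
    by congr pair => /=; rewrite /GRing.scale /= ?mulr0 ?mulr1 ?addr0 ?add0r.
  by rewrite linearP linearZ dx dr; congr (_ + _); exact: mulrC.
rewrite prod_normE /=; congr (`|_| <= _).
by rewrite /g /= (addrC h) (addrC k) opprD addrA.
Qed.

(** * Contraction of the linear delay equation *)

Section ShiftRow.
Variables (R : realType) (n : nat).
Implicit Types (w : 'rV[R]_n.+1).

(** Windows list the most recent value first: a new value enters at position 0
    and the oldest one is dropped. *)
Definition shift_row (h : R) w : 'rV[R]_n.+1 :=
  \row_j if unlift ord0 j is Some i then w 0 (widen_ord (leqnSn n) i) else h.

Lemma shift_row0 h w : shift_row h w 0 0 = h.
Proof. by rewrite mxE unlift_none. Qed.

Lemma shift_row_lift h w i :
  shift_row h w 0 (lift ord0 i) = w 0 (widen_ord (leqnSn n) i).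
Proof. by rewrite mxE liftK. Qed.

Lemma shift_row_le h w c : `|h| <= c -> `|w| <= c -> `|shift_row h w| <= c.
Proof.
move=> hc wc; apply: row_norm_le => [|j]; first exact: le_trans hc.
rewrite mxE; case: unliftP => [i|] _ //; exact: le_trans (row_coord_le _ _) wc.
Qed.

Lemma shift_rowB h h' w w' :
  shift_row h w - shift_row h' w' = shift_row (h - h') (w - w').
Proof. by apply/rowP => j; rewrite !mxE; case: unlift => // i; rewrite !mxE. Qed.

End ShiftRow.

Section DelaySystem.
Variables (R : realType) (m : nat) (a b : nat -> R).
Hypotheses (aP : forall k, a (k + m.+1)%N = a k) (bP : forall k, b (k + m.+1)%N = b k).

Definition delay_step k (w : 'rV[R]_m.+2) : 'rV[R]_m.+2 :=
  shift_row (a k * w 0 0 + b k * w 0 ord_max) w.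

Lemma delay_step_is_linear k : linear (delay_step k).
Proof.
move=> c v w; apply/rowP => j; rewrite !mxE.
by case: unlift => [i|]; rewrite ?mxE //; ring.
Qed.

HB.instance Definition _ k := GRing.isLinear.Build R 'rV[R]_m.+2 'rV[R]_m.+2 *:%R
  (delay_step k) (delay_step_is_linear k).

Definition delay_flow s k w := flow delay_step s w k.

Lemma delay_flow_is_linear s k : linear (delay_flow s k).
Proof.
move=> c v w; rewrite /delay_flow.
by elim: k => //= k ->; rewrite linearP.
Qed.

HB.instance Definition _ s k := GRing.isLinear.Build R 'rV[R]_m.+2 'rV[R]_m.+2
  *:%R (delay_flow s k) (delay_flow_is_linear s k).

(** Each entry of a window is a former head entry, so the flow of windows is
    governed by the scalar sequence of heads. *)
Lemma delay_flow_coord s w k (i : 'I_m.+2) : (i <= k)%N ->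
  delay_flow s k w 0 i = delay_flow s (k - i) w 0 0.
Proof.
elim: k i => [|k IH] i; first by rewrite leqn0 => /eqP i0; congr (_ 0 _); exact: val_inj.
case: (unliftP ord0 i) => [j|] -> /= ik; last by [].
rewrite /delay_flow /= shift_row_lift.
exact: IH.
Qed.

(** The heads satisfy the scalar delay equation.  Sampling at the times
    j.+1 * m.+1 leaves at least m.+1 steps before the sampling time, enough
    for every entry to be such a head. *)
Lemma delay_flow_cvg0 s w (i : 'I_m.+2) :
  (forall (t : nat) (y : R[i]), root (map_poly (real_complex R)
      (delay_char m.+1 (fun l => a (t + l)%N) (fun l => b (t + l)%N))) y ->
    `|y| < 1) ->
  (fun j => delay_flow s (j.+1 * m.+1) w 0 i) @ \oo --> (0 : R).
Proof.
move=> ab1; pose z k := delay_flow s k w 0 0.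
have im : (i <= m.+1)%N by rewrite -ltnS.
rewrite (_ : (fun _ => _) = fun j => z (m.+1 - i + j * m.+1)%N); last first.
  apply/funext => j; rewrite delay_flow_coord; last first.
    by rewrite mulSn (leq_trans im) // leq_addr.
  by rewrite mulSn addnC -addnBA // addnC.
apply: (@delay_recurrence_cvg0 _ _ z (fun k => a (s + k)%N) (fun k => b (s + k)%N)).
- by move=> k; rewrite addnA aP.
- by move=> k; rewrite addnA bP.
- move=> k; rewrite /z /delay_flow /= shift_row0 addnA aP bP.
  congr (_ + _ * _); rewrite -/(delay_flow s (k + m.+1) w) delay_flow_coord /=.
    by rewrite addnK.
  exact: leq_addl.
- move=> y; under [X in delay_char _ X _]eq_fun do rewrite addnA.
  under [X in delay_char _ _ X]eq_fun do rewrite addnA.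
  exact: ab1.
Qed.

Lemma flow_eq_phase (V : normedModType R) (F : nat -> V -> V) s s' w k :
  (forall l, F (s + l)%N = F (s' + l)%N) -> flow F s w k = flow F s' w k.
Proof. by move=> Fs; elim: k => //= k ->; rewrite Fs. Qed.

Lemma delay_step_mod s l :
  delay_step (s + l) = delay_step (s %% m.+1 + l).
Proof.
suff h (c : nat -> R) : (forall k, c (k + m.+1)%N = c k) ->
    c (s + l)%N = c (s %% m.+1 + l)%N.
  by apply/funext => w; rewrite /delay_step !h.
by move=> cP; rewrite {1}(divn_eq s m.+1) -addnA addnC period_mul.
Qed.

(** Uniformity in s and w: periodicity leaves m.+1 starting times and linearity
    m.+2 initial windows, the unit vectors. *)
Lemma delay_flow_contracts :
  (forall (t : nat) (y : R[i]), root (map_poly (real_complex R)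
      (delay_char m.+1 (fun l => a (t + l)%N) (fun l => b (t + l)%N))) y ->
    `|y| < 1) ->
  exists2 N, (0 < N)%N & forall s w, `|flow delay_step s w N| <= `|w| / 2.
Proof.
move=> ab1; pose e : R := (m.+2)%:R^-1 / 2.
have e0 : 0 < e by rewrite divr_gt0 // invr_gt0 ltr0n.
have [K _ small] : \forall k \near \oo, forall (s : 'I_m.+1) (i j : 'I_m.+2),
    `|delay_flow s (k.+1 * m.+1) (delta_mx 0 j) 0 i| <= e.
  apply: filter_forall => s; apply: filter_forall => i; apply: filter_forall => j.
  by move/cvgr0Pnorm_le: (delay_flow_cvg0 s (delta_mx 0 j) i ab1); apply.
exists (K.+1 * m.+1)%N => // s w.
rewrite (@flow_eq_phase _ _ _ (s %% m.+1)); last exact: delay_step_mod.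
have sm : (s %% m.+1 < m.+1)%N by rewrite ltn_mod.
rewrite -/(delay_flow _ _ _) [in leLHS](row_sum_delta w) linear_sum /=.
apply: row_norm_le => [|i]; first by rewrite divr_ge0.
rewrite summxE (le_trans (ler_norm_sum _ _ _)) //.
apply: (@le_trans _ _ (\sum_(j < m.+2) `|w| * e)).
  apply: ler_sum => j _; rewrite linearZ mxE normrM ler_pM ?row_coord_le //.
  exact: (small K (leqnn K) (Ordinal sm)).
rewrite sumr_const card_ord -mulrnAr /e -mulrnAl -[X in X / 2]mulr_natr.
by rewrite mulVf ?pnatr_eq0 // mul1r.
Qed.

Lemma delay_step_bounded : exists2 K, 1 <= K &
  forall k w, `|delay_step k w| <= K * `|w|.
Proof.
pose S := \sum_(l < m.+1) (`|a l| + `|b l|).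
have S0 : 0 <= S by rewrite sumr_ge0 // => l _; rewrite addr_ge0.
exists (1 + S) => [|k w]; first by rewrite lerDl.
have := delay_step_mod k 0; rewrite !addn0 => ->.
have km : (k %% m.+1 < m.+1)%N by rewrite ltn_mod.
apply: shift_row_le; last by rewrite ler_peMl // lerDl.
apply: le_trans (ler_normD _ _) _; rewrite !normrM.
apply: (@le_trans _ _ (S * `|w|)); last by rewrite ler_wpM2r // lerDr.
rewrite /S (bigD1 (Ordinal km)) //= mulrDl -[leLHS]addr0 lerD //.
  by rewrite mulrDl lerD // ler_wpM2l // row_coord_le.
by rewrite mulr_ge0 // sumr_ge0 // => l _; rewrite addr_ge0.
Qed.

End DelaySystem.

(** * The controlled system around the orbit *)

Lemma uniform_radius (R : realType) (I : finType) (P : I -> R -> Prop) :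
  (forall i r r', r' <= r -> P i r -> P i r') ->
  (forall i, exists2 r, 0 < r & P i r) -> exists2 r, 0 < r & forall i, P i r.
Proof.
move=> Pmono Pex.
have Pnear : \forall r \near (0 : R)^'+, forall i, P i r.
  apply: filter_forall => i; have [r r0 Pr] := Pex i.
  by apply: filterS (nbhs_right_ltW r0) => r' /= /Pmono; apply.
have [r [r0 Pr]] := filter_ex (filterI (nbhs_right_gt (0 : R)) Pnear).
by exists r.
Qed.

Lemma inZpD n (s t : nat) : (inZp (s + t) : 'I_n.+1) = inZp s + inZp t.
Proof. by apply: val_inj; rewrite /= modnDm. Qed.

Lemma inZp_period n (k : nat) : (inZp (k + n.+1) : 'I_n.+1) = inZp k.
Proof. by apply: val_inj; rewrite /= modnDr. Qed.

Lemma inZp_ord n (i : 'I_n.+1) : inZp i = i.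
Proof. by apply: val_inj; rewrite /= modn_small. Qed.

Lemma coord_le_eucl (R : realType) d (v : 'rV[R]_d) j : `|v 0 j| <= eucl_norm v.
Proof.
rewrite /eucl_norm -sqrtr_sqr ler_wsqrtr // (bigD1 j) //= lerDl.
by rewrite sumr_ge0 // => i _; rewrite sqr_ge0.
Qed.

Lemma eucl_norm_le (R : realType) d (v : 'rV[R]_d.+1) c :
  0 <= c -> (forall j, `|v 0 j| <= c) -> eucl_norm v <= c * d.+1%:R.
Proof.
move=> c0 vc; have cd : 0 <= c * d.+1%:R by rewrite mulr_ge0.
rewrite -(ger0_norm cd) -sqrtr_sqr ler_wsqrtr //.
apply: (@le_trans _ _ (\sum_(j < d.+1) c ^+ 2)).
  by apply: ler_sum => j _; rewrite -real_normK ?num_real // lerXn2r ?nnegrE.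
rewrite sumr_const card_ord -[leLHS]mulr_natr exprMn ler_wpM2l ?sqr_ge0 //.
by rewrite -natrX ler_nat leq_pmulr.
Qed.

Section ErrorDynamics.
Variables (R : realType) (n : nat) (f : R -> R -> R) (r0 : R).
Variables (p gamma : 'I_n.+1 -> R).
Hypothesis fD : forall z : R * R, differentiable (fun w : R * R => f w.1 w.2) z.
Hypothesis pS : forall i, p (i + inZp 1) = f (p i) r0.

(** One step of the closed loop in the coordinates w = window - orbit_window.
    The control may use w 0 0 - w 0 ord_max for x_k - x_(k-m), since both values
    are compared with the same orbit point, one period apart. *)
Definition loop_step k (w : 'rV[R]_n.+2) : 'rV[R]_n.+2 :=
  let i : 'I_n.+1 := inZp k in
  shift_row (f (p i + w 0 0) (r0 + gamma i * (w 0 0 - w 0 ord_max))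
             - p (i + inZp 1)) w.

Let a k := a11 f r0 p gamma (inZp k).
Let b k := a1m1 f r0 p gamma (inZp k).

(** Only the head entry is nonlinear; there the increments of x and r are w 0 0
    and gamma i * (w 0 0 - w 0 ord_max), both at most (1 + 2 |gamma i|) |w|. *)
Lemma loop_step_linearization eta : 0 < eta -> exists2 rho, 0 < rho &
  forall k w, `|w| <= rho -> `|loop_step k w - delay_step a b k w| <= eta * `|w|.
Proof.
move=> eta0.
pose h i (w : 'rV[R]_n.+2) := gamma i * (w 0 0 - w 0 ord_max).
have [|i|rho rho0 small] := @uniform_radius R 'I_n.+1 (fun i rho =>
    forall w : 'rV[R]_n.+2, `|w| <= rho ->
    `|f (p i + w 0 0) (r0 + h i w) - f (p i) r0
      - (f_x f (p i) r0 * w 0 0 + f_r f (p i) r0 * h i w)| <= eta * `|w|).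
- by move=> i r r' r'r small w wr; apply: small; apply: le_trans r'r.
- pose C := 1 + 2 * `|gamma i|.
  have C0 : 0 < C by rewrite ltr_pwDl // mulr_ge0.
  have [|rho rho0 small] := @partial_remainder _ f (p i) r0 (eta / C) (fD _).
    by rewrite divr_gt0.
  exists (rho / C) => [|w wrho]; first by rewrite divr_gt0.
  have w0C : `|w 0 0| <= C * `|w|.
    by rewrite (le_trans (row_coord_le _ _)) // ler_peMl // lerDl mulr_ge0.
  have hC : `|h i w| <= C * `|w|.
    have := ler_normB (w 0 0) (w 0 ord_max).
    have := row_coord_le w 0; have := row_coord_le w ord_max => w1 w2 w3.
    rewrite normrM; apply: (@le_trans _ _ (`|gamma i| * (2 * `|w|))).
      by rewrite ler_wpM2l //; lra.
    by rewrite /C; have := normr_ge0 w; lra.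
  have wC : C * `|w| <= rho by rewrite mulrC -ler_pdivlMr.
  apply: le_trans (small _ _ (le_trans w0C wC) (le_trans hC wC)) _.
  rewrite mulrAC -mulrA ler_wpM2l ?(ltW eta0) // ler_pdivrMr //.
  by rewrite (mulrC `|w|) ge_max w0C hC.
exists rho => // k w wrho; rewrite shift_rowB subrr.
apply: shift_row_le; last by rewrite normr0 mulr_ge0 // ltW.
rewrite pS; apply: le_trans (small (inZp k) w wrho).
rewrite le_eqVlt; apply/predU1l; rewrite /a /b /a11 /a1m1 /h.
by congr (`|_|); ring.
Qed.

(** Starting the period at another time only permutes the factors of chi. *)
Lemma delay_char_chi t :
  delay_char n.+1 (fun l => a (t + l)%N) (fun l => b (t + l)%N) = chi f r0 p gamma.
Proof.
rewrite /delay_char /chi; congr (_ + _).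
rewrite [RHS](reindex_inj (addrI (inZp t))); apply: eq_bigr => l _ /=.
by rewrite /a /b inZpD inZp_ord.
Qed.

Hypothesis chi_stable : forall z : R[i],
  root (map_poly (real_complex R) (chi f r0 p gamma)) z -> `|z| < 1.

Lemma loop_stable r : 0 < r -> exists2 rho, 0 < rho &
  forall s w, `|w| <= rho ->
    (forall k, `|flow loop_step s w k| <= r) /\
    (fun k => `|flow loop_step s w k|) @ \oo --> (0 : R).
Proof.
have aP k : a (k + n.+1)%N = a k by rewrite /a inZp_period.
have bP k : b (k + n.+1)%N = b k by rewrite /b inZp_period.
have [K K1 bnd] := delay_step_bounded aP bP.
have [|N N0 contr] := delay_flow_contracts aP bP.
  by move=> t y; rewrite delay_char_chi; exact: chi_stable.
exact: (flow_asymptotically_stable K1 bnd loop_step_linearization N0 contr).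
Qed.

Lemma error_flow (x u : nat -> R) k0 i : (n.+1 <= k0)%N ->
  (forall k, x k.+1 = f (x k) (r0 + u k)) ->
  (forall k, (k0 <= k)%N -> u k = gamma (i + inZp (k - k0)) * (x k - x (k - n.+1)%N)) ->
  forall k, window n x (k0 + k) - orbit_window p (i + inZp k) =
    flow loop_step i (window n x k0 - orbit_window p i) k.
Proof.
move=> nk0 xS uE; have i0 : inZp 0 = 0 :> 'I_n.+1 by exact: val_inj.
elim=> [|k IH]; first by rewrite addn0 i0 addr0.
rewrite [RHS]/= -IH {IH} /loop_step; apply/rowP => j; rewrite !mxE.
rewrite inZpD inZp_ord; case: (unliftP ord0 j) => [l|] -> /=.
  rewrite !mxE /= /bump /= add1n addnS subSS; congr (_ - p _).
  by rewrite -[k.+1]addn1 -[l.+1]addn1 !inZpD addrA opprD addrACA subrr addr0.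
rewrite /= !subn0 i0 subr0 addnS xS uE ?leq_addr // addKn.
have -> : inZp n.+1 = 0 :> 'I_n.+1 by apply: val_inj; rewrite /= modnn.
rewrite subr0 -(addn1 k) inZpD addrA; congr (f _ (_ + _ * _) - _); ring.
Qed.

(** A visit close enough to p 0 is followed by n.+1 steps along the orbit, by
    continuity of the iterates; at the end of them a complete window, read
    backwards, is close to orbit_window p 0. *)
Lemma capture_occurs eps x0 :
  0 < eps -> (forall U, nbhs (p 0) U -> exists k, U (iter k (f^~ r0) x0)) ->
  exists k i, (n.+1 <= k)%N /\ captured p eps (fun k => iter k (f^~ r0) x0) k i.
Proof.
move=> eps0 visits; set g := f^~ r0.
pose eta := eps / Num.sqrt 2 / n.+2%:R.
have eta0 : 0 < eta by rewrite !divr_gt0 // ?sqrtr_gt0 // ltr0n.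
have gC : continuous g.
  move=> y; apply: (@continuous_comp _ _ _ (fun y => (y, r0)) (fun w => f w.1 w.2)).
    exact: (cvg_pair (G := nbhs y) (H := nbhs r0) cvg_id (cvg_cst r0)).
  exact: differentiable_continuous.
have iterC k : continuous (iter k g).
  elim: k => [|k IH] y; first exact: cvg_id.
  exact: (@continuous_comp _ _ _ (iter k g) g y (IH y) (gC _)).
have iterp k : iter k g (p 0) = p (inZp k).
  elim: k => [|k IH]; first by congr p; exact: val_inj.
  by rewrite iterS IH -addn1 inZpD pS.
pose close (j : 'I_n.+2) y := `|iter j g y - p (inZp j)| <= eta.
have close_near : \forall y \near p 0, forall j, close j y.
  apply: (@filter_forall _ _ close (nbhs (p 0)) _) => j.
  have /cvgrPdist_le/(_ eta eta0) := iterC j (p 0).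
  by apply: filterS => y /=; rewrite iterp distrC.
have [k kclose] := visits _ close_near.
exists (k + n.+1)%N, 0; split; first exact: leq_addl.
have n2 : n.+2%:R != 0 :> R by rewrite pnatr_eq0.
rewrite /captured -[leRHS](divfK n2); apply: eucl_norm_le => [|j]; first exact: ltW.
have jn : (j <= n.+1)%N by rewrite -ltnS.
rewrite !mxE -addnBA // addnC iterD.
have := kclose (inord (n.+1 - j)); rewrite /close inordK ?ltnS ?leq_subr //.
have -> // : inZp (n.+1 - j) = 0 - inZp j :> 'I_n.+1.
apply/eqP; rewrite sub0r -addr_eq0 -inZpD subnK //.
by apply/eqP/val_inj; rewrite /= modnn.
Qed.

(** Were there no k0, the control would vanish for ever, and the trajectory
    would be an uncontrolled one, which is captured. *)
Lemma k0_exists eps x0 x u : 0 < eps -> closed_loop f r0 p gamma eps x0 x u ->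
  (forall U, nbhs (p 0) U -> exists k, U (iter k (f^~ r0) x0)) ->
  exists k0, is_k0 p eps x k0.
Proof.
move=> eps0 [x00 xS [uoff _]] visits.
apply: contrapT => no_k0.
have u0 k : u k = 0 by apply: uoff => k0 k0P; case: no_k0; exists k0.
have xE : (fun k => iter k (f^~ r0) x0) = x.
  apply/funext; elim=> [|k IH]; first by rewrite x00.
  by rewrite iterS IH xS u0 addr0.
have [k' [i' [nk ck]]] := capture_occurs eps0 visits; rewrite xE in ck.
have ex : exists k, (n.+1 <= k)%N && [exists i, captured p eps x k i].
  by exists k'; rewrite nk; apply/existsP; exists i'.
apply: no_k0; case: (ex_minnP ex) => k0 /andP[nk0 /existsP ck0] k0min.
exists k0; split=> // l nl cl; apply: k0min; rewrite nl; exact/existsP.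
Qed.

End ErrorDynamics.

(** * Chaos control by delayed feedback *)

Theorem proposition3 (R : realType) (n : nat) (f : R -> R -> R) (r0 : R)
  (A B : set R) (p gamma : 'I_n.+1 -> R) (delta : R) :
  continuously_differentiable f ->
  strange_attractor (f^~ r0) A ->
  B = basin_of_attraction (f^~ r0) A ->
  A `<=` B ->
  UPO (f^~ r0) p ->
  (forall i, A (p i)) ->
  ergodicity_assumption (f^~ r0) p B ->
  (forall z : R[i], root (map_poly (real_complex R) (chi f r0 p gamma)) z ->
     `|z| < 1) ->
  0 < delta ->
  let gmax := \big[Num.max/0]_(j < n.+1) `|gamma j| in
  exists eps0 : R,
    [/\ 0 < eps0,
        forall i j : 'I_n.+1, i != j ->
          eps0 < eucl_norm (orbit_window p i - orbit_window p j) / Num.sqrt 2,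
        gmax != 0 -> eps0 < delta / gmax &
        forall eps : R, 0 < eps -> eps < eps0 ->
          {ae @lebesgue_measure R, forall x0 : R, B x0 ->
             forall x u : nat -> R, closed_loop f r0 p gamma eps x0 x u ->
               (forall k, `|u k| <= delta) /\ converges_to_orbit p x}].
Proof.
move=> [fD _ _] _ _ _ [[p_inj pS] _] _ ergodic chi1 delta0 gmax.
have gmax_le j : `|gamma j| <= gmax by exact: (le_bigmax _ (fun j => `|gamma j|)).
have gmax0 : 0 <= gmax by exact: le_trans (gmax_le 0).
(* If the window stays within r of the orbit, then |u_k| <= gmax * 2 r <= delta. *)
pose r := delta / (2 * (gmax + 1)).
have g1 : 0 < 2 * (gmax + 1) by rewrite mulr_gt0 // ltr_wpDl.
have r_gt0 : 0 < r by rewrite divr_gt0.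
have [rho rho0 stable] := loop_stable fD pS chi1 r_gt0.
have s2 : 0 < Num.sqrt 2 :> R by rewrite sqrtr_gt0.
pose gap (i j : 'I_n.+1) :=
  eucl_norm (orbit_window p i - orbit_window p j) / Num.sqrt 2.
have gap0 i j : i != j -> 0 < gap i j.
  move=> ij; rewrite divr_gt0 //.
  apply: lt_le_trans (coord_le_eucl (orbit_window p i - orbit_window p j) 0).
  rewrite normr_gt0 !mxE subr_eq0.
  by apply: contraNneq ij => /p_inj/addIr ->.
have [|[i j]|eps1 eps10 eps1gap] := @uniform_radius R ('I_n.+1 * 'I_n.+1)%type
    (fun ij e => ij.1 != ij.2 -> e < gap ij.1 ij.2).
- by move=> ij e e' e'e h ij_neq; apply: le_lt_trans e'e (h ij_neq).
- have [->|ij] := eqVneq i j; first by exists 1 => //; rewrite eqxx.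
  by have := gap0 i j ij => gij; exists (gap i j / 2) => [|_] /=; lra.
pose D := if gmax == 0 then 1 else delta / gmax.
have D0 : 0 < D.
  rewrite /D; case: eqVneq => // gn0; rewrite divr_gt0 // lt_neqAle eq_sym gn0 //.
(* The term rho * sqrt 2 makes the capture radius eps / sqrt 2 at most rho. *)
exists (Num.min eps1 (Num.min (D / 2) (rho * Num.sqrt 2))); split.
- by rewrite !lt_min eps10 divr_gt0 // mulr_gt0.
- by move=> i j ij; rewrite gt_min (eps1gap (i, j)).
- move=> gn0; have -> : delta / gmax = D by rewrite /D (negbTE gn0).
  by rewrite !gt_min; apply/orP; right; apply/orP; left; lra.
move=> eps eps0; rewrite !lt_min => /and3P[_ _ eps_rho].
apply: (@filterS _ _ (ae_filter_ringOfSetsType _) _ _ _ ergodic) => x0 visits Bx0 x u loop.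
have [k0 k0P] := k0_exists fD pS eps0 loop (visits Bx0 0).
have [_ xS [uoff uon]] := loop.
have [nk0 _ _] := k0P; have [i ci uE] := uon _ k0P.
set w0 := window n x k0 - orbit_window p i.
have w0rho : `|w0| <= rho.
  apply: row_norm_le => [|j]; first exact: ltW.
  apply: le_trans (coord_le_eucl _ _) _; apply: le_trans ci _.
  by rewrite ler_pdivrMr // ltW.
have [bounded conv] := stable i w0 w0rho.
have err := error_flow p nk0 xS uE.
have xw k j : (window n x (k0 + k) - orbit_window p (i + inZp k)) 0 j =
    x (k0 + k - j)%N - p (i + inZp k - inZp j) by rewrite !mxE.
have i0 : inZp 0 = 0 :> 'I_n.+1 by exact: val_inj.
have in0 : inZp n.+1 = 0 :> 'I_n.+1 by apply: val_inj; rewrite /= modnn.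
split=> [k|].
  have [kk0|k0k] := ltnP k k0.
    rewrite uoff ?normr0 ?ltW // => k1 k1P.
    have [_ _ k0min] := k0P; have [nk1 ck1 _] := k1P.
    by apply: leq_trans kk0 _; apply: k0min.
  rewrite uE // -{2 3}(subnKC k0k) normrM; set l := (k - k0)%N.
  have ex0 : `|x (k0 + l)%N - p (i + inZp l)| <= r.
    have := bounded l; rewrite -err; apply: le_trans.
    have := row_coord_le (window n x (k0 + l) - orbit_window p (i + inZp l)) 0.
    by rewrite xw subn0 i0 subr0.
  have exn : `|x (k0 + l - n.+1)%N - p (i + inZp l)| <= r.
    have := bounded l; rewrite -err; apply: le_trans.
    have := row_coord_le (window n x (k0 + l) - orbit_window p (i + inZp l)) ord_max.
    by rewrite xw /= in0 subr0.
  have : `|x (k0 + l)%N - x (k0 + l - n.+1)%N| <= 2 * r.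
    have := ler_normB (x (k0 + l)%N - p (i + inZp l))
      (x (k0 + l - n.+1)%N - p (i + inZp l)).
    rewrite opprB addrA subrK; lra.
  move=> xx; apply: le_trans (ler_pM _ _ (gmax_le _) xx) _ => //.
  rewrite /r mulrCA mulrA mulrA ler_pdivrMr //; have := ltW delta0; nra.
exists (i - inZp k0); apply/cvgr0Pnorm_le => e e0.
move/cvgr0Pnorm_le: conv => /(_ e e0)[N _ convN].
exists (k0 + N)%N => // k /= k0Nk.
have k0k : (k0 <= k)%N by rewrite (leq_trans _ k0Nk) // leq_addr.
have /convN : (N <= k - k0)%N by rewrite leq_subRL.
rewrite /= !normr_id -err; apply: le_trans.
have := row_coord_le (window n x (k0 + (k - k0)) - orbit_window p (i + inZp (k - k0))) 0.
rewrite xw subn0 i0 subr0; apply: le_trans.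
by rewrite -{2}(subnKC k0k) inZpD subnKC // addrA subrK.
Qed.
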